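(* Let $f$ be an arithmetic function such that $\widetilde{f}(n) := \sum_{d\mid n} f(d) \neq 0$ for all $n \geq 1$. For $n,k \geq 1$ let \[ s_{n,k}(f) := [q^n]\, (q;q)_\infty \sum_{m \geq 1} T_{\mathrm{Div}}(m,k)\,\widetilde{f}(m)\, q^m , \] which is the unique array (independent of $g$) such that for every arithmetic function $g$, $\sum_{n \geq 1} \frac{a_{fg}(n) q^n}{1-q^n} = \frac{1}{(q;q)_\infty}\sum_{n\geq 1}\sum_{k=1}^n s_{n,k}(f) g(k) q^n$, where $a_{fg}(n) := \sum_{d\mid n}\widetilde f(d)\widetilde g(d)\mu(n/d)$ and $\widetilde g(n):=\sum_{d\mid n} g(d)$. Then the lower-triangular matrix $(s_{n,k}(f))_{n,k \geq 1}$ is invertible, and the entries of its inverse are \[ s_{n,k}^{(-1)}(f) = \sum_{d \mid n} \frac{p(d-k)}{\widetilde{f}(d)}\, \mu(n/d), \qquad n,k \geq 1 . \]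
   Context: Arithmetic functions are maps $\mathbb{Z}_{>0}\to\mathbb{C}$; $\mu$ is the Möbius function; $p(m)$ is the number of partitions of $m$, with $p(0)=1$ and $p(m)=0$ for $m<0$. $(q;q)_\infty := \prod_{m\ge1}(1-q^m)$. $T_{\mathrm{Div}}(m,k)=1$ if $k\mid m$ and $0$ otherwise. $[q^n]$ denotes extraction of the coefficient of $q^n$. *)

(* Defs.v *)
From HB Require Import structures.
From mathcomp Require Import all_boot all_order all_algebra.
From mathcomp Require Import complex.
From mathcomp Require Import reals.

Set Implicit Arguments.
Unset Strict Implicit.
Unset Printing Implicit Defensive.

Import GRing.Theory.
Local Open Scope ring_scope.

(** * Formal power series, given by their coefficient sequences *)

Definition fps (F : Type) : Type := nat -> F.

Definition fps_of_poly (F : fieldType) (p : {poly F}) : fps F := fun n => p`_n.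

Definition fps_mul (F : fieldType) (a b : fps F) : fps F :=
  fun n => \sum_(i < n.+1) a i * b (n - i)%N.

(* The first n coefficients of 1 / a, obtained by solving a * b = 1 degree by
   degree; meaningful when a 0 != 0, see [fps_mulV]. *)
Fixpoint fps_inv_seq (F : fieldType) (a : fps F) (n : nat) : seq F :=
  if n is m.+1 then
    let s := fps_inv_seq a m in
    rcons s ((a 0%N)^-1 * ((m == 0%N)%:R - \sum_(i < m) a (m - i)%N * s`_i))
  else [::].

Definition fps_inv (F : fieldType) (a : fps F) : fps F :=
  fun n => (fps_inv_seq a n.+1)`_n.

(* sum_(m >= 1) c m * q^m, with zero constant term whatever c 0 is. *)
Definition gen_series (F : fieldType) (c : nat -> F) : fps F :=
  fun m => if (0 < m)%N then c m else 0.

(* Convergence in the q-adic topology. *)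
Definition fps_cvg (F : fieldType) (u : nat -> fps F) (l : fps F) : Prop :=
  forall m, exists N0, forall N, (N0 <= N)%N -> u N m = l m.

(* (q;q)_oo: the factors with index > n do not change the coefficient of q^n,
   see [qq_inf_cvg]. *)
Definition qq_inf (F : fieldType) : fps F :=
  fun n => (\prod_(1 <= m < n.+1) (1 - 'X^m) : {poly F})`_n.

Definition lambert_term (F : fieldType) (n : nat) : fps F :=
  fps_mul (fps_of_poly 'X^n) (fps_inv (fps_of_poly (1 - 'X^n))).

(* sum_(n >= 1) a n * q^n / (1 - q^n): the terms with index > m do not change
   the coefficient of q^m, see [lambert_cvg]. *)
Definition lambert (F : fieldType) (a : nat -> F) : fps F :=
  fun m => \sum_(1 <= n < m.+1) a n * lambert_term F n m.

Lemma size_fps_inv_seq (F : fieldType) (a : fps F) n :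
  size (fps_inv_seq a n) = n.
Proof. by elim: n => //= n IHn; rewrite size_rcons IHn. Qed.

Lemma nth_fps_inv_seq (F : fieldType) (a : fps F) n i : (i < n)%N ->
  (fps_inv_seq a n)`_i = fps_inv a i.
Proof.
elim: n => //= n IHn; rewrite ltnS leq_eqVlt => /predU1P [-> //|ltin].
by rewrite nth_rcons size_fps_inv_seq ltin IHn.
Qed.

Lemma fps_mulV (F : fieldType) (a : fps F) : a 0%N != 0 ->
  fps_mul a (fps_inv a) =1 fps_of_poly 1.
Proof.
move=> a0 n; rewrite /fps_mul big_ord_recl subn0 /fps_of_poly coef1 /=.
rewrite {1}/fps_inv /= nth_rcons size_fps_inv_seq ltnn eqxx mulVKf //.
rewrite -[RHS]addr0 -addrA; congr (_ + _); rewrite addrC; apply/eqP.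
rewrite subr_eq0; apply/eqP; rewrite (reindex_inj rev_ord_inj) /=.
apply: eq_bigr => i _; rewrite nth_fps_inv_seq // /bump /= add1n subnSK //.
by rewrite subKn // ltnW.
Qed.

Lemma qq_inf_cvg (F : fieldType) :
  fps_cvg (fun N => fps_of_poly (\prod_(1 <= m < N.+1) (1 - 'X^m)))
          (qq_inf F).
Proof.
move=> m; exists m => N /subnK <-; elim: (N - m)%N => // k IHk.
rewrite -IHk /fps_of_poly addSn big_nat_recr //= mulrBr mulr1 coefB coefMXn.
by rewrite ltnS leq_addl subr0.
Qed.

Lemma lambert_cvg (F : fieldType) (a : nat -> F) :
  fps_cvg (fun N m => \sum_(1 <= n < N.+1) a n * lambert_term F n m)
          (lambert a).
Proof.
move=> m; exists m => N /subnK <-; elim: (N - m)%N => // k IHk.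
rewrite -IHk addSn big_nat_recr //= [X in a _ * X]big1 ?mulr0 ?addr0 // => i _.
rewrite /fps_of_poly coefXn; have := ltn_ord i; rewrite ltnS => lim.
by rewrite ltn_eqF ?mul0r // ltnS (leq_trans lim) // leq_addl.
Qed.

(** * Arithmetic functions

   An arithmetic function is a map [nat -> F] of which only the values at
   positive integers are ever used ([divisors n] never contains 0). *)

Definition div_sum (F : fieldType) (f : nat -> F) (n : nat) : F :=
  \sum_(d <- divisors n) f d.

Definition moebius (F : fieldType) (n : nat) : F :=
  if all (fun p => logn p n == 1%N) (primes n)
  then (-1) ^+ size (primes n) else 0.

Definition T_Div (F : fieldType) (m k : nat) : F := (k %| m)%N%:R.

(* a_{fg}; it is a function of f and g, not of their product. *)
Definition a_fg (F : fieldType) (f g : nat -> F) (n : nat) : F :=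
  \sum_(d <- divisors n) div_sum f d * div_sum g d * moebius F (n %/ d).

Definition s_mat (F : fieldType) (f : nat -> F) (n k : nat) : F :=
  fps_mul (qq_inf F) (gen_series (fun m => T_Div F m k * div_sum f m)) n.

(** * Integer partitions *)

Definition is_partition (n : nat) (s : seq nat) : bool :=
  [&& sorted geq s, 0%N \notin s & sumn s == n].

(* A partition of n has at most n parts, each at most n, so that restricting to
   the finite type of such sequences loses nothing, see [partition_bounded]. *)
Definition npart (n : nat) : nat :=
  #|[set s : n.-bseq 'I_n.+1 | is_partition n [seq val i | i <- s]]|.

Definition npartz (m : int) : nat := if m is Posz n then npart n else 0%N.

Lemma partition_bounded n (s : seq nat) : is_partition n s ->
  exists t : n.-bseq 'I_n.+1, [seq val i | i <- t] = s.
Proof.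
case/and3P => _ s_gt0 /eqP sum_s.
have szs : (size s <= n)%N.
  rewrite -sum_s; elim: s s_gt0 {sum_s} => //= x s IHs.
  rewrite inE negb_or eq_sym -lt0n => /andP [x0 /IHs les].
  by rewrite -add1n leq_add.
have les x : x \in s -> (x <= n)%N.
  rewrite -sum_s; elim: s {s_gt0 sum_s szs} => //= y s IHs.
  rewrite inE => /predU1P [-> | /IHs lex]; first exact: leq_addr.
  exact: leq_trans lex (leq_addl _ _).
have szt : (size [seq (inord x : 'I_n.+1) | x <- s] <= n)%N by rewrite size_map.
exists (Bseq szt); rewrite /= -map_comp -[RHS]map_id; apply/eq_in_map => x xs.
by rewrite /= inordK // ltnS les.
Qed.

(** * Infinite lower-triangular matrices, with rows and columns indexed by the
   positive integers *)

Definition lower_triangular (F : fieldType) (A : nat -> nat -> F) : Prop :=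
  forall n k, (0 < n)%N -> (n < k)%N -> A n k = 0.

(* Row n of a lower-triangular A vanishes beyond column n, so the matrix product
   is a finite sum. *)
Definition lt_mul (F : fieldType) (A B : nat -> nat -> F) (n k : nat) : F :=
  \sum_(1 <= j < n.+1) A n j * B j k.

Definition lt_is_inverse (F : fieldType) (A B : nat -> nat -> F) : Prop :=
  lower_triangular B /\
  forall n k, (0 < n)%N -> (0 < k)%N ->
    lt_mul A B n k = (n == k)%:R /\ lt_mul B A n k = (n == k)%:R.

Definition lt_invertible (F : fieldType) (A : nat -> nat -> F) : Prop :=
  lower_triangular A /\ exists B, lt_is_inverse A B.

(** * The factorization property characterizing [s_mat] *)

Definition lambert_factorization (F : fieldType) (f : nat -> F)
    (s : nat -> nat -> F) : Prop :=
  forall (g : nat -> F) (n : nat),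
    lambert (a_fg f g) n =
    fps_mul (fps_inv (qq_inf F))
      (gen_series (fun m => \sum_(1 <= k < m.+1) s m k * g k)) n.

(* Main.v *)
Require Import Defs.
From mathcomp Require Import all_boot all_algebra.
From mathcomp Require Import complex.
From mathcomp Require Import reals.

Set Implicit Arguments.
Unset Strict Implicit.
Unset Printing Implicit Defensive.

Import GRing.Theory.
Local Open Scope ring_scope.

(**
  Write T(a) for the lower-triangular Toeplitz matrix of a power series a, D for
  the divisibility matrix and h for the divisor sum of f.  By definition
  s = T((q;q)_oo) diag(h) D.  Each factor has an explicit inverse:
  T((q;q)_oo)^-1 is the Toeplitz matrix of the partition numbers (Euler),
  and D^-1 has entries mu(n/k) for k | n (Moebius inversion).  Hence
  s^-1 = D^-1 diag(1/h) T(p), which is the stated formula.  Since a Lambert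
  series has coefficients D a, the series of a_fg has coefficients
  h(n) (D g)(n), so a matrix t has the factorization property if and only if
  t g = T((q;q)_oo) (h . D g) for all g; taking for g an indicator function
  recovers each column of t.
*)

(** * Lower-triangular matrices *)

Section LowerTriangular.

Variable F : fieldType.
Implicit Types (A B C : nat -> nat -> F) (u v h : nat -> F).

Definition lt_mulv A u (n : nat) : F := \sum_(1 <= j < n.+1) A n j * u j.

Definition lt_diag h (n k : nat) : F := h n *+ (n == k).

Definition lt_one (n k : nat) : F := (n == k)%:R.

Definition lt_eq A B := forall n k, (0 < n)%N -> (0 < k)%N -> A n k = B n k.

Lemma lt_mulE A B n k : lt_mul A B n k = lt_mulv A (B^~ k) n.
Proof. by []. Qed.

Lemma eq_lt_mulv A B u v n :
    (forall j, (0 < j)%N -> A n j = B n j) ->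
    (forall j, (0 < j)%N -> u j = v j) ->
  lt_mulv A u n = lt_mulv B v n.
Proof.
by move=> AB uv; apply: eq_big_nat => j /andP [j0 _]; rewrite AB ?uv.
Qed.

Lemma lt_mulv_widen A u n N : lower_triangular A -> (0 < n <= N)%N ->
  lt_mulv A u n = \sum_(1 <= j < N.+1) A n j * u j.
Proof.
move=> Alt /andP [n0 nN]; rewrite [RHS](big_cat_nat (n := n.+1)) //=.
rewrite [X in _ + X]big1_seq ?addr0 // => j /=.
by rewrite mem_index_iota => /andP [nj _]; rewrite Alt ?mul0r.
Qed.

Lemma lt_mulvA A B u n : lower_triangular B ->
  lt_mulv A (lt_mulv B u) n = lt_mulv (lt_mul A B) u n.
Proof.
move=> Blt; transitivity
  (\sum_(1 <= j < n.+1) \sum_(1 <= i < n.+1) A n j * (B j i * u i)).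
  by apply: eq_big_nat => j jn; rewrite (lt_mulv_widen u Blt jn) mulr_sumr.
rewrite exchange_big; apply: eq_bigr => i _; rewrite mulr_suml.
by apply: eq_bigr => j _; rewrite mulrA.
Qed.

Lemma lt_mulv_diag h u n : (0 < n)%N -> lt_mulv (lt_diag h) u n = h n * u n.
Proof.
move=> n0; rewrite /lt_mulv /lt_diag.
under eq_bigr do rewrite eq_sym mulrb (fun_if ( *%R^~ _)) mul0r.
by rewrite -big_mkcond big_nat1_eq n0 ltnSn.
Qed.

Lemma lt_mulv1 u n : (0 < n)%N -> lt_mulv lt_one u n = u n.
Proof. by move=> n0; rewrite -[RHS]mul1r -(lt_mulv_diag (fun=> 1)). Qed.

Lemma lt_mulv_indicator A n k : (0 < k <= n)%N ->
  lt_mulv A (fun j => (j == k)%:R) n = A n k.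
Proof.
move=> kn; rewrite /lt_mulv; under eq_bigr do rewrite mulr_natr mulrb.
by rewrite -big_mkcond big_nat1_eq ltnS kn.
Qed.

Lemma lt_diag_lower h : lower_triangular (lt_diag h).
Proof. by move=> n k _ nk; rewrite /lt_diag ltn_eqF. Qed.

Lemma lt_mul_lower A B : lower_triangular A -> lower_triangular B ->
  lower_triangular (lt_mul A B).
Proof.
move=> Alt Blt n k n0 nk; apply: big1_seq => j /=.
rewrite mem_index_iota => /andP [j0 jn].
by rewrite Blt ?mulr0 // (leq_ltn_trans _ nk).
Qed.

Definition trunc_mx (N : nat) A : 'M[F]_N := \matrix_(i, j) A i.+1 j.+1.

Lemma trunc_mxM N A B : lower_triangular A ->
  trunc_mx N (lt_mul A B) = trunc_mx N A *m trunc_mx N B.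
Proof.
move=> Alt; apply/matrixP => i k; rewrite !mxE lt_mulE.
rewrite (lt_mulv_widen _ Alt (N := N)) ?ltn_ord // big_add1 big_mkord.
by apply: eq_bigr => j _; rewrite !mxE.
Qed.

Lemma trunc_mx1 N : trunc_mx N lt_one = 1%:M.
Proof. by apply/matrixP => i j; rewrite !mxE. Qed.

Lemma trunc_mx_inj A B : (forall N, trunc_mx N A = trunc_mx N B) -> lt_eq A B.
Proof.
move=> AB [//|n] [//|k] _ _.
have [ltn ltk] : (n < (maxn n k).+1)%N /\ (k < (maxn n k).+1)%N.
  by rewrite !ltnS leq_maxl leq_maxr.
have /matrixP/(_ (Ordinal ltn) (Ordinal ltk)) := AB (maxn n k).+1.
by rewrite !mxE.
Qed.

Lemma lt_is_inverseP A B : lower_triangular A ->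
  lt_is_inverse A B <->
  lower_triangular B /\ forall N, trunc_mx N A *m trunc_mx N B = 1%:M.
Proof.
move=> Alt; split=> -[Blt AB]; split=> //; [move=> N | move=> n k n0 k0].
  rewrite -trunc_mxM // -trunc_mx1; apply/matrixP => i j; rewrite !mxE.
  by have [->] := AB i.+1 j.+1 isT isT.
split; apply: (trunc_mx_inj (B := lt_one)) => // N.
  by rewrite trunc_mxM // AB trunc_mx1.
by rewrite trunc_mxM // (mulmx1C (AB N)) trunc_mx1.
Qed.

(* The truncations are finite square matrices, for which a right inverse is also
   a left inverse. *)
Lemma lt_right_inverse A B : lower_triangular A -> lower_triangular B ->
  lt_eq (lt_mul A B) lt_one -> lt_is_inverse A B.
Proof.
move=> Alt Blt AB; apply/lt_is_inverseP => //; split=> // N.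
by rewrite -trunc_mxM // -trunc_mx1; apply/matrixP => i j; rewrite !mxE AB.
Qed.

Lemma lt_diag_inverse h : (forall n, (0 < n)%N -> h n != 0) ->
  lt_is_inverse (lt_diag h) (lt_diag (fun n => (h n)^-1)).
Proof.
move=> h0; apply: lt_right_inverse; try exact: lt_diag_lower.
by move=> n k n0 _; rewrite lt_mulE lt_mulv_diag // /lt_diag mulrnAr mulfV ?h0.
Qed.

Lemma lt_mul_inverse A A' B B' : lower_triangular A -> lower_triangular B ->
    lt_is_inverse A A' -> lt_is_inverse B B' ->
  lt_is_inverse (lt_mul A B) (lt_mul B' A').
Proof.
move=> Alt Blt /lt_is_inverseP [] // A'lt AA' /lt_is_inverseP [] // B'lt BB'.
apply/lt_is_inverseP; first exact: lt_mul_lower.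
split=> [|N]; first exact: lt_mul_lower.
by rewrite !trunc_mxM // mulmxA -(mulmxA _ _ (trunc_mx N B')) BB' mulmx1 AA'.
Qed.

Lemma lt_inverse_unique A B C : lower_triangular A ->
  lt_is_inverse A B -> lt_is_inverse A C -> lt_eq B C.
Proof.
move=> Alt /lt_is_inverseP [] // _ AB /lt_is_inverseP [] // _ AC.
apply: trunc_mx_inj => N; rewrite -[LHS]mulmx1 -(AC N) mulmxA.
by rewrite (mulmx1C (AB N)) mul1mx.
Qed.

Lemma eq_lt_is_inverse A A' B B' : lt_eq A A' -> lt_eq B B' ->
  lt_is_inverse A B -> lt_is_inverse A' B'.
Proof.
move=> AA' BB' [Blt AB]; split=> [n k n0 nk | n k n0 k0].
  by rewrite -BB' ?Blt // (ltn_trans n0).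
have [ABnk BAnk] := AB n k n0 k0.
by split; [rewrite -ABnk | rewrite -BAnk]; apply: eq_lt_mulv => j j0;
  rewrite ?AA' ?BB'.
Qed.

Lemma lt_mulv_cancel A B u n : lower_triangular B ->
    lt_eq (lt_mul A B) lt_one -> (0 < n)%N ->
  lt_mulv A (lt_mulv B u) n = u n.
Proof.
move=> Blt AB n0; rewrite lt_mulvA // -[RHS]lt_mulv1 //.
by apply: eq_lt_mulv => // j; apply: AB.
Qed.

Lemma lt_mulKv A B u n : lower_triangular A -> lt_is_inverse A B -> (0 < n)%N ->
  lt_mulv B (lt_mulv A u) n = u n.
Proof.
by move=> Alt [_ AB]; apply: lt_mulv_cancel => // i j i0 j0; case: (AB i j).
Qed.

Lemma lt_mulKVv A B u n : lt_is_inverse A B -> (0 < n)%N ->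
  lt_mulv A (lt_mulv B u) n = u n.
Proof.
by move=> [Blt AB]; apply: lt_mulv_cancel => // i j i0 j0; case: (AB i j).
Qed.

End LowerTriangular.

(** * Formal power series and Toeplitz matrices *)

Section PowerSeries.

Variable F : fieldType.
Implicit Types (a b c : fps F) (p q : {poly F}).

Definition fps_trunc (N : nat) a : {poly F} := \poly_(i < N.+1) a i.

Lemma coef_fps_trunc N a n : (n <= N)%N -> (fps_trunc N a)`_n = a n.
Proof. by move=> nN; rewrite coef_poly ltnS nN. Qed.

Lemma eq_fps_mul a a' b b' n :
    (forall i, (i <= n)%N -> a i = a' i) ->
    (forall i, (i <= n)%N -> b i = b' i) ->
  fps_mul a b n = fps_mul a' b' n.
Proof.
by move=> aa' bb'; apply: eq_bigr => i _; rewrite aa' ?bb' ?leq_subr // -ltnS.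
Qed.

Lemma fps_mul_coefM a b p q n :
    (forall i, (i <= n)%N -> a i = p`_i) ->
    (forall i, (i <= n)%N -> b i = q`_i) ->
  fps_mul a b n = (p * q)`_n.
Proof. by move=> ap bq; rewrite coefM; apply: eq_fps_mul. Qed.

Lemma fps_mul_poly p a n : fps_mul (fps_of_poly p) a n = (p * fps_trunc n a)`_n.
Proof. by apply: fps_mul_coefM => // i /coef_fps_trunc ->. Qed.

Lemma fps_mul_trunc a b N n : (n <= N)%N ->
  fps_mul a b n = (fps_trunc N a * fps_trunc N b)`_n.
Proof.
by move=> nN; apply: fps_mul_coefM => i le_in;
  rewrite coef_fps_trunc // (leq_trans le_in).
Qed.

Lemma fps_mulC a b : fps_mul a b =1 fps_mul b a.
Proof. by move=> n; rewrite !(fps_mul_trunc _ _ (leqnn n)) mulrC. Qed.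

Lemma fps_mulA a b c : fps_mul a (fps_mul b c) =1 fps_mul (fps_mul a b) c.
Proof.
move=> n; have truncE d i : (i <= n)%N -> d i = (fps_trunc n d)`_i.
  by move/coef_fps_trunc.
have truncM d e i : (i <= n)%N ->
    fps_mul d e i = (fps_trunc n d * fps_trunc n e)`_i.
  exact: fps_mul_trunc.
by rewrite (fps_mul_coefM (truncE a) (truncM b c))
  (fps_mul_coefM (truncM a b) (truncE c)) mulrA.
Qed.

Lemma fps_mul1 a : fps_mul (fps_of_poly 1) a =1 a.
Proof. by move=> n; rewrite fps_mul_poly mul1r coef_fps_trunc. Qed.

Lemma fps_mul_polyM p q a :
  fps_mul (fps_of_poly (p * q)) a =1
  fps_mul (fps_of_poly p) (fps_mul (fps_of_poly q) a).
Proof.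
move=> n; rewrite fps_mulA; apply: eq_fps_mul => // i _.
by rewrite /fps_of_poly coefM.
Qed.

Lemma fps_inv_unique a b : fps_mul a b =1 fps_of_poly 1 -> fps_inv a =1 b.
Proof.
move=> ab n; have a0 : a 0%N != 0.
  apply/eqP => a0; have /eqP := ab 0%N.
  by rewrite /fps_mul big_ord1 a0 mul0r /fps_of_poly coef1 eq_sym oner_eq0.
rewrite -[LHS]fps_mul1 -(eq_fps_mul (fun i _ => ab i) (fun _ _ => erefl)).
rewrite fps_mulC fps_mulA -[RHS]fps_mul1; apply: eq_fps_mul => // i _.
by rewrite fps_mulC fps_mulV.
Qed.

Definition toeplitz a (n k : nat) : F := if (k <= n)%N then a (n - k)%N else 0.

Lemma toeplitz_lower a : lower_triangular (toeplitz a).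
Proof. by move=> n k _ nk; rewrite /toeplitz leqNgt nk. Qed.

Lemma fps_mulXn k a n : fps_mul (fps_of_poly 'X^k) a n = toeplitz a n k.
Proof.
rewrite fps_mul_poly coefXnM /toeplitz; case: leqP => // _.
by rewrite coef_fps_trunc ?leq_subr.
Qed.

Lemma fps_mul1BXn k a n :
  fps_mul (fps_of_poly (1 - 'X^k)) a n = a n - toeplitz a n k.
Proof. by rewrite -fps_mulXn -[a n]fps_mul1 !fps_mul_poly mulrBl coefB. Qed.

Lemma fps_mul_gen_series a (u : nat -> F) n :
  fps_mul a (gen_series u) n = lt_mulv (toeplitz a) u n.
Proof.
rewrite fps_mulC /fps_mul big_ord_recl mul0r add0r /lt_mulv big_add1 big_mkord.
by apply: eq_bigr => i _; rewrite /toeplitz ltn_ord mulrC.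
Qed.

(* Column k of T(b) is the series q^k b. *)
Lemma toeplitz_mul a b n k : (0 < k)%N ->
  lt_mul (toeplitz a) (toeplitz b) n k = toeplitz (fps_mul a b) n k.
Proof.
move=> k0; rewrite lt_mulE -fps_mul_gen_series -fps_mulXn fps_mulA.
transitivity (fps_mul a (fps_mul (fps_of_poly 'X^k) b) n).
  apply: eq_fps_mul => // -[|i] _; rewrite fps_mulXn //.
  by rewrite /toeplitz leqNgt k0.
by rewrite fps_mulA; apply: eq_fps_mul => // i _; apply: fps_mulC.
Qed.

Lemma toeplitz_inverse a b : fps_mul a b =1 fps_of_poly 1 ->
  lt_is_inverse (toeplitz a) (toeplitz b).
Proof.
move=> ab; apply: lt_right_inverse; try exact: toeplitz_lower.
move=> n k _ k0; rewrite toeplitz_mul // /toeplitz ab /fps_of_poly coef1.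
by rewrite subn_eq0 /lt_one eqn_leq andbC; case: leqP.
Qed.

Lemma fps_inv_1BXn k : (0 < k)%N ->
  fps_inv (fps_of_poly (1 - 'X^k)) =1 fun n => (k %| n)%N%:R :> F.
Proof.
move=> k0; apply: fps_inv_unique => n.
rewrite fps_mul1BXn /toeplitz /fps_of_poly coef1; case: leqP => [kn | nk].
  by rewrite -{1}(subnK kn) dvdn_addl // subrr gtn_eqF // (leq_trans k0).
by rewrite subr0; case: n nk => [|n] nk; rewrite ?dvdn0 ?gtnNdvd.
Qed.

Lemma lambert_termE k n : (0 < k)%N -> (0 < n)%N ->
  lambert_term F k n = T_Div F n k.
Proof.
move=> k0 n0; rewrite /lambert_term fps_mulXn /toeplitz /T_Div.
case: leqP => [kn|nk]; last by rewrite gtnNdvd.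
by rewrite fps_inv_1BXn // -[in RHS](subnK kn) dvdn_addl.
Qed.

Lemma lambertE (u : nat -> F) n : lambert u n = lt_mulv (T_Div F) u n.
Proof.
apply: eq_big_nat => k /andP [k0 kn].
by rewrite lambert_termE 1?mulrC // (leq_trans k0).
Qed.

End PowerSeries.

(** * Sums over divisors and Moebius inversion *)

Section BigDivisors.

Variables (R : Type) (idx : R) (op : Monoid.com_law idx).

Lemma eq_big_uniq (I : eqType) (r1 r2 : seq I) (P1 P2 : pred I) (u : I -> R) :
    uniq r1 -> uniq r2 ->
    (forall i, (i \in r1) && P1 i = (i \in r2) && P2 i) ->
  \big[op/idx]_(i <- r1 | P1 i) u i = \big[op/idx]_(i <- r2 | P2 i) u i.
Proof.
move=> r1_uniq r2_uniq r12; rewrite -big_filter -[RHS]big_filter.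
apply/perm_big/uniq_perm; rewrite ?filter_uniq // => i.
by rewrite !mem_filter !(andbC _ (_ \in _)).
Qed.

Lemma big_divisors n (u : nat -> R) : (0 < n)%N ->
  \big[op/idx]_(d <- divisors n) u d =
  \big[op/idx]_(1 <= d < n.+1 | (d %| n)%N) u d.
Proof.
move=> n0; apply: eq_big_uniq; rewrite ?divisors_uniq ?iota_uniq // => d.
rewrite -dvdn_divisors // andbT mem_index_iota ltnS.
case: (boolP (d %| n)%N) => [dn|]; last by rewrite andbF.
by rewrite (dvdn_gt0 n0 dn) (dvdn_leq n0 dn).
Qed.

Lemma big_divisors_multiple n k (u : nat -> R) : (0 < n)%N -> (k %| n)%N ->
  \big[op/idx]_(d <- divisors n | (k %| d)%N) u d =
  \big[op/idx]_(e <- divisors (n %/ k)) u (e * k)%N.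
Proof.
move=> n0 kn; have k0 := dvdn_gt0 n0 kn.
have nk0 : (0 < n %/ k)%N by rewrite divn_gt0 // (dvdn_leq n0 kn).
rewrite -(big_map (muln^~ k) xpredT); apply: eq_big_uniq => [||d].
- exact: divisors_uniq.
- rewrite map_inj_uniq ?divisors_uniq // => x y /eqP.
  by rewrite eqn_pmul2r // => /eqP.
rewrite andbT -dvdn_divisors //; apply/andP/mapP => [[dn /dvdnP [e dE]]|[e]].
  by exists e; rewrite // -dvdn_divisors // dvdn_divRL // -dE.
by rewrite -dvdn_divisors // dvdn_divRL // => en ->; rewrite dvdn_mull.
Qed.

End BigDivisors.

Section Moebius.

Variable F : fieldType.

Lemma moebius_eq0 p n : (1 < logn p n)%N -> moebius F n = 0.
Proof.
move=> log_gt1; rewrite /moebius; case: allP => // /(_ p).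
by rewrite -logn_gt0 ltnW // gtn_eqF // => /(_ isT).
Qed.

Lemma moebius_mul_prime n p : prime p -> (0 < n)%N ->
  moebius F (n * p) = if (p %| n)%N then 0 else - moebius F n.
Proof.
move=> p_pr n0; have p0 := prime_gt0 p_pr; case: ifPn => [pn | pNn].
  apply: (@moebius_eq0 p); rewrite lognM // (logn_prime _ p_pr) eqxx addn1 ltnS.
  by rewrite logn_gt0 mem_primes p_pr n0.
have p_primes : p \notin primes n by rewrite mem_primes (negPf pNn) !andbF.
have perm_np : perm_eq (primes (n * p)) (p :: primes n).
  apply: uniq_perm; rewrite /= ?primes_uniq ?p_primes // => q.
  by rewrite primesM // (primes_prime p_pr) !inE orbC.
rewrite /moebius (perm_all _ perm_np) (perm_size perm_np) /=.
rewrite lognM // (logn_prime _ p_pr) eqxx lognE (negPf pNn) !andbF /=.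
have -> : all (fun q => logn q (n * p) == 1%N) (primes n) =
          all (fun q => logn q n == 1%N) (primes n).
  apply: eq_in_all => q qn; rewrite lognM // (logn_prime _ p_pr).
  by have [qp|_] := eqVneq q p; rewrite ?addn0 // -qp qn in p_primes *.
by case: ifP; rewrite ?oppr0 // exprS mulN1r.
Qed.

(* For a prime p dividing n, d |-> d * p pairs the divisors of n prime to p with
   those exactly divisible by p, and reverses the sign of moebius. *)
Lemma sum_moebius n : (0 < n)%N ->
  \sum_(d <- divisors n) moebius F d = (n == 1%N)%:R.
Proof.
move=> n0; have [->|n1] := eqVneq n 1%N; first by rewrite big_seq1.
have [|p p_pr pn] := @pdivP n; first by rewrite ltn_neqAle eq_sym n1.
have np0 : (0 < n %/ p)%N by rewrite divn_gt0 ?prime_gt0 // (dvdn_leq n0 pn).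
rewrite (bigID (dvdn p)) /= big_divisors_multiple //.
have -> : \sum_(e <- divisors (n %/ p)) moebius F (e * p) =
          - \sum_(e <- divisors (n %/ p) | ~~ (p %| e)%N) moebius F e.
  rewrite -sumrN [RHS]big_mkcond; apply: eq_big_seq => e.
  rewrite -dvdn_divisors // => /(dvdn_gt0 np0) e0.
  by rewrite moebius_mul_prime // if_neg.
apply/eqP; rewrite addrC subr_eq0; apply/eqP.
apply: eq_big_uniq; rewrite ?divisors_uniq // => d.
rewrite -!dvdn_divisors // andbC [RHS]andbC.
case: (boolP (p %| d)%N) => //= pNd.
by rewrite -[in LHS](divnK pn) Gauss_dvdl // coprime_sym prime_coprime.
Qed.

Definition moebius_mx (n k : nat) : F :=
  if (k %| n)%N then moebius F (n %/ k) else 0.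

Lemma T_Div_lower : lower_triangular (T_Div F).
Proof. by move=> n k n0 nk; rewrite /T_Div gtnNdvd. Qed.

Lemma lt_mulv_T_Div (u : nat -> F) n : (0 < n)%N ->
  lt_mulv (T_Div F) u n = div_sum u n.
Proof.
move=> n0; rewrite /div_sum big_divisors // big_mkcond; apply: eq_bigr => d _.
by rewrite /T_Div mulr_natl mulrb.
Qed.

Lemma lt_mulv_moebius_mx (u : nat -> F) n : (0 < n)%N ->
  lt_mulv moebius_mx u n = \sum_(d <- divisors n) u d * moebius F (n %/ d).
Proof.
move=> n0; rewrite big_divisors // big_mkcond; apply: eq_bigr => d _.
by rewrite /moebius_mx; case: ifP => _; rewrite ?mul0r 1?mulrC.
Qed.

Lemma T_Div_inverse : lt_is_inverse (T_Div F) moebius_mx.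
Proof.
apply: lt_right_inverse => [|n k n0 nk|n k n0 k0]; first exact: T_Div_lower.
  by rewrite /moebius_mx gtnNdvd.
rewrite lt_mulE lt_mulv_T_Div // /div_sum -big_mkcond /lt_one.
have [kn | kNn] := boolP (k %| n)%N.
  rewrite big_divisors_multiple //; under eq_bigr do rewrite mulnK //.
  rewrite sum_moebius ?divn_gt0 ?(dvdn_leq n0 kn) //.
  by rewrite eq_sym eqn_div // mul1n eq_sym.
have -> : n == k = false by apply: contraNF kNn => /eqP ->.
apply: big1_seq => d /andP [kd]; rewrite -dvdn_divisors // => dn.
by rewrite (dvdn_trans kd dn) in kNn.
Qed.

Lemma lambert_a_fg (f g : nat -> F) n : (0 < n)%N ->
  lambert (a_fg f g) n = div_sum f n * div_sum g n.
Proof.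
move=> n0; rewrite lambertE.
rewrite -[RHS](lt_mulKVv (fun m => div_sum f m * div_sum g m) T_Div_inverse n0).
by apply: eq_lt_mulv => // m m0; rewrite lt_mulv_moebius_mx.
Qed.

End Moebius.

(** * The generating function of the partition numbers *)

Section Partitions.

(* A partition is weakly decreasing, so its head is its largest part. *)
Definition bounded_partition (m n : nat) (s : seq nat) : bool :=
  is_partition n s && (head 0%N s <= m)%N.

Lemma is_partition_cons n x s :
  is_partition n (x :: s) =
  [&& 0 < x, x <= n & bounded_partition x (n - x) s]%N.
Proof.
have path_head : path geq x s = (head 0%N s <= x)%N && sorted geq s by case: s.
have sum_cons : (x + sumn s == n)%N = (x <= n)%N && (sumn s == n - x)%N.
  have [xn|nx] := leqP x n; first by rewrite -{1}(subnKC xn) eqn_add2l.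
  by rewrite gtn_eqF // ltn_addr.
rewrite /bounded_partition /is_partition /= path_head sum_cons inE negb_or.
by rewrite eq_sym -lt0n !andbA [LHS](ACl (3*5*2*4*6*1)).
Qed.

Lemma is_partition_head_leq n s : is_partition n s -> (head 0%N s <= n)%N.
Proof. by case: s => // x s; rewrite is_partition_cons => /and3P []. Qed.

Definition bounded_partitions (m n : nat) : seq (seq nat) :=
  [seq [seq val i | i <- s] | s : n.-bseq 'I_n.+1 in
     [pred s : n.-bseq 'I_n.+1 | bounded_partition m n [seq val i | i <- s]]].

Lemma mem_bounded_partitions m n s :
  (s \in bounded_partitions m n) = bounded_partition m n s.
Proof.
apply/imageP/idP => [[t tP ->] // | sP].
have /andP [/partition_bounded [t tE] _] := sP.
by exists t; rewrite ?inE tE.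
Qed.

Lemma bounded_partitions_uniq m n : uniq (bounded_partitions m n).
Proof.
rewrite map_inj_uniq ?enum_uniq // => s t /(inj_map val_inj) st.
exact: val_inj.
Qed.

Lemma npartE m n : (n <= m)%N -> npart n = size (bounded_partitions m n).
Proof.
move=> nm; rewrite /npart size_image; apply: eq_card => s; rewrite !inE.
rewrite /bounded_partition; case: (boolP (is_partition _ _)) => //= sP.
by rewrite (leq_trans (is_partition_head_leq sP)).
Qed.

Lemma size_bounded_partitions0 n : size (bounded_partitions 0 n) = (n == 0%N).
Proof.
have perm0 : perm_eq (bounded_partitions 0 n) (nseq (n == 0%N) [::]).
  apply: uniq_perm; rewrite ?bounded_partitions_uniq //; first by case: eqP.
  move=> [|x s]; rewrite mem_bounded_partitions mem_nseq /bounded_partition.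
    by rewrite /is_partition /= andbT andbC eq_sym; case: (n == 0%N).
  by rewrite is_partition_cons andbF; case: x => //= x; rewrite andbF.
by rewrite (perm_size perm0) size_nseq.
Qed.

(* A partition with parts at most m + 1 either has no part m + 1, or starts with
   such a part. *)
Lemma size_bounded_partitionsS m n :
  size (bounded_partitions m.+1 n) = (size (bounded_partitions m n) +
    if m < n then size (bounded_partitions m.+1 (n - m.+1)) else 0)%N.
Proof.
pose with_max := [seq m.+1 :: s |
  s <- if (m < n)%N then bounded_partitions m.+1 (n - m.+1) else [::]].
have perm_max : perm_eq (bounded_partitions m.+1 n)
                        (bounded_partitions m n ++ with_max).
  apply: uniq_perm; first exact: bounded_partitions_uniq.
    rewrite cat_uniq bounded_partitions_uniq map_inj_uniq => [/=|s t [] //].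
    apply/andP; split; last by case: ifP; rewrite ?bounded_partitions_uniq.
    apply/hasPn => _ /mapP [s _ ->]; rewrite mem_bounded_partitions.
    by rewrite /bounded_partition /= ltnn andbF.
  move=> [|x s]; rewrite mem_cat !mem_bounded_partitions.
    by rewrite orbC; case: mapP => [[]|].
  rewrite /bounded_partition is_partition_cons /=.
  have [-> | xm] := eqVneq x m.+1.
    rewrite ltnn !andbF leqnn andbT mem_map => [|t u [] //].
    by case: ifP; rewrite ?mem_bounded_partitions.
  have /negPf -> : x :: s \notin with_max.
    by apply: contra xm => /mapP [t _ [-> _]]; rewrite eqxx.
  by rewrite orbF [(x <= m.+1)%N]leq_eqVlt (negPf xm).
by rewrite (perm_size perm_max) size_cat (size_map (cons m.+1)) (fun_if size).
Qed.

Variable F : fieldType.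

Definition part_series : fps F := fun n => (npart n)%:R.

Lemma toeplitz_part_series n k :
  toeplitz part_series n k = (npartz (n%:Z - k%:Z))%:R.
Proof.
rewrite /toeplitz /part_series; case: leqP => [kn|nk]; first by rewrite subzn.
by rewrite -opprB (subzn (ltnW nk)) -(prednK (n := k - n)) ?subn_gt0.
Qed.

Lemma fps_mul_prod_partitions m :
  fps_mul (fps_of_poly (\prod_(1 <= i < m.+1) (1 - 'X^i)))
          (fun n => (size (bounded_partitions m n))%:R : F) =1 fps_of_poly 1.
Proof.
elim: m => [|m IHm] n.
  rewrite big_nil fps_mul1 size_bounded_partitions0 /fps_of_poly coef1.
  by case: eqP.
rewrite big_nat_recr //= fps_mul_polyM -IHm; apply: eq_fps_mul => // i _.
rewrite fps_mul1BXn /toeplitz size_bounded_partitionsS.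
by case: ifP; rewrite ?addn0 ?subr0 // natrD addrK.
Qed.

Lemma qq_inf_coef i n : (i <= n)%N ->
  qq_inf F i = (\prod_(1 <= m < n.+1) (1 - 'X^m) : {poly F})`_i.
Proof.
rewrite /qq_inf => /subnK <-; elim: (n - i)%N => // k ->.
rewrite addSn [in RHS]big_nat_recr //= mulrBr mulr1 coefB coefMXn.
by rewrite ltnS leq_addl subr0.
Qed.

Lemma fps_mul_qq_inf_part_series :
  fps_mul (qq_inf F) part_series =1 fps_of_poly 1.
Proof.
move=> n; rewrite -(fps_mul_prod_partitions n n); apply: eq_fps_mul => i le_in.
  exact: qq_inf_coef.
by rewrite /part_series (npartE le_in).
Qed.

Lemma toeplitz_qq_inf_inverse :
  lt_is_inverse (toeplitz (qq_inf F)) (toeplitz part_series).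
Proof. exact: toeplitz_inverse fps_mul_qq_inf_part_series. Qed.

Lemma fps_mul_inv_qq_inf u n :
  fps_mul (fps_inv (qq_inf F)) (gen_series u) n =
  lt_mulv (toeplitz part_series) u n.
Proof.
rewrite -fps_mul_gen_series; apply: eq_fps_mul => // i _.
exact: fps_inv_unique fps_mul_qq_inf_part_series i.
Qed.

End Partitions.

(** * The factorization matrix *)

Section Factorization.

Variables (F : fieldType) (f : nat -> F).

Lemma lambert_factorizationP t :
  lambert_factorization f t <->
  forall g n, (0 < n)%N -> lt_mulv t g n =
    lt_mulv (toeplitz (qq_inf F)) (fun m => div_sum f m * div_sum g m) n.
Proof.
have qq_inverse := toeplitz_qq_inf_inverse F.
split=> [ft g n n0 | tE g [|n]].
- rewrite -(lt_mulKVv (lt_mulv t g) qq_inverse n0); apply: eq_lt_mulv => // m m0.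
  by rewrite -fps_mul_inv_qq_inf -ft lambert_a_fg.
- by rewrite fps_mul_inv_qq_inf /lambert /lt_mulv !big_nil.
rewrite lambert_a_fg // fps_mul_inv_qq_inf.
rewrite -[LHS](lt_mulKv (fun m => div_sum f m * div_sum g m)
  (toeplitz_lower _) qq_inverse (ltn0Sn n)).
by apply: eq_lt_mulv => // m m0; rewrite -tE.
Qed.

Lemma lambert_factorization_unique s t :
    lambert_factorization f s -> lambert_factorization f t ->
  forall n k, (0 < k)%N -> (k <= n)%N -> s n k = t n k.
Proof.
move=> /lambert_factorizationP sE /lambert_factorizationP tE n k k0 kn.
have k_range : (0 < k <= n)%N by rewrite k0.
by rewrite -!(lt_mulv_indicator _ k_range) sE ?tE // (leq_trans k0).
Qed.

Lemma s_matE n k :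
  s_mat f n k =
  lt_mul (toeplitz (qq_inf F)) (lt_mul (lt_diag (div_sum f)) (T_Div F)) n k.
Proof.
rewrite /s_mat fps_mul_gen_series lt_mulE; apply: eq_lt_mulv => // m m0.
by rewrite lt_mulE lt_mulv_diag // mulrC.
Qed.

Lemma diag_T_Div_lower :
  lower_triangular (lt_mul (lt_diag (div_sum f)) (T_Div F)).
Proof. by apply: lt_mul_lower; [apply: lt_diag_lower | apply: T_Div_lower]. Qed.

Lemma s_mat_lower : lower_triangular (s_mat f).
Proof.
move=> n k n0 nk; rewrite s_matE lt_mul_lower //; first exact: toeplitz_lower.
exact: diag_T_Div_lower.
Qed.

Lemma s_mat_factorization : lambert_factorization f (s_mat f).
Proof.
apply/lambert_factorizationP => g n n0.
rewrite (eq_lt_mulv (fun k _ => s_matE n k) (fun _ _ => erefl)).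
rewrite -(lt_mulvA _ _ _ diag_T_Div_lower); apply: eq_lt_mulv => // m m0.
by rewrite -(lt_mulvA _ _ _ (T_Div_lower F)) lt_mulv_diag // lt_mulv_T_Div.
Qed.

Definition s_mat_inv (n k : nat) : F :=
  \sum_(d <- divisors n)
     (npartz (d%:Z - k%:Z))%:R / div_sum f d * moebius F (n %/ d).

Lemma s_mat_invE n k : (0 < n)%N ->
  s_mat_inv n k =
  lt_mul (lt_mul (moebius_mx F) (lt_diag (fun d => (div_sum f d)^-1)))
         (toeplitz (part_series F)) n k.
Proof.
move=> n0; rewrite lt_mulE -(lt_mulvA _ _ _ (lt_diag_lower _)).
rewrite /s_mat_inv -lt_mulv_moebius_mx //; apply: eq_lt_mulv => // d d0.
by rewrite lt_mulv_diag // toeplitz_part_series mulrC.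
Qed.

Lemma s_mat_inverse : (forall n, (0 < n)%N -> div_sum f n != 0) ->
  lt_is_inverse (s_mat f) s_mat_inv.
Proof.
move=> f0; apply: eq_lt_is_inverse => [n k n0 k0 | n k n0 k0 |].
- by rewrite s_matE.
- by rewrite s_mat_invE.
apply: lt_mul_inverse.
- exact: toeplitz_lower.
- exact: diag_T_Div_lower.
- exact: toeplitz_qq_inf_inverse.
apply: lt_mul_inverse; [exact: lt_diag_lower | exact: T_Div_lower | |].
- exact: lt_diag_inverse.
exact: T_Div_inverse.
Qed.

End Factorization.

Theorem mainTheorem2 (R : realType) (f : nat -> R[i])
    (hf : forall n : nat, (0 < n)%N -> div_sum f n != 0) :
  [/\ lambert_factorization f (s_mat f),
      (forall t : nat -> nat -> R[i], lambert_factorization f t ->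
         forall n k : nat, (0 < k)%N -> (k <= n)%N -> t n k = s_mat f n k),
      lt_invertible (s_mat f)
    & forall t : nat -> nat -> R[i], lt_is_inverse (s_mat f) t ->
        forall n k : nat, (0 < n)%N -> (0 < k)%N ->
          t n k = \sum_(d <- divisors n)
                    (npartz (d%:Z - k%:Z))%:R / div_sum f d * moebius _ (n %/ d)].
Proof.
have s_inv := s_mat_inverse hf; have s_lower := s_mat_lower f.
split.
- exact: s_mat_factorization.
- move=> t ft; exact: lambert_factorization_unique ft (s_mat_factorization f).
- by split; last by exists (s_mat_inv f).
- by move=> t st; exact: lt_inverse_unique s_lower st s_inv.
Qed.
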